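(* Let $W\in\mathbb{C}^{N\times N}$ be Hermitian positive definite and let $\vec b\in\mathbb{C}^N$ with $\|\vec b\|_2=1$. Run the Lanczos iteration on $(W,\vec b)$ and suppose it terminates at step $n\le N$, producing the $n\times n$ Jacobi matrix $T=T(W,\vec b)$. Let $T=HH^T$ be the Cholesky factorization of $T$, where $H$ is the lower-bidiagonal $n\times n$ matrix with diagonal entries $\alpha_0,\alpha_1,\dots,\alpha_{n-1}>0$ and subdiagonal entries $\beta_0,\dots,\beta_{n-2}$ (i.e. $H_{j+1,j+1}=\alpha_j$, $H_{j+2,j+1}=\beta_j$). (a) For the conjugate gradient algorithm (CGA) applied to $W\vec x=\vec b$ with $\vec x_0=0$, for every $k<n$, $$\|\vec r_k(W,\vec b)\|_2=\prod_{j=0}^{k-1}\frac{\beta_j}{\alpha_j},\qquad \|\vec e_k(W,\vec b)\|_W=\|\vec r_k(W,\vec b)\|_2\sqrt{\vec f_1^*(L_kL_k^T)^{-1}\vec f_1},\quad L_k=H_{k+1:n,\,k+1:n}.$$ (b) For the MINRES algorithm applied to $W\vec x=\vec b$, for every $k<n$, $$\|\vec r_k(W,\vec b)\|_2=\Big(\sum_{j=0}^k\prod_{\ell=0}^{j-1}\frac{\alpha_\ell^2}{\beta_\ell^2}\Big)^{-1/2}$$ (empty products equal $1$). Moreover $\vec r_n=0$.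
   Context: Lanczos iteration on $(W,\vec q_1)$, $\|\vec q_1\|_2=1$, $W=W^*$: set $b_{-1}=1$, $\vec q_0=0$; for $k=1,2,\dots$: $a_{k-1}=(W\vec q_k-b_{k-2}\vec q_{k-1})^*\vec q_k$, $\vec v_k=W\vec q_k-a_{k-1}\vec q_k-b_{k-2}\vec q_{k-1}$, $b_{k-1}=\|\vec v_k\|_2$; if $b_{k-1}\neq0$ set $\vec q_{k+1}=\vec v_k/b_{k-1}$, otherwise terminate. If it terminates at step $n$, $T(W,\vec q_1)$ is the $n\times n$ symmetric tridiagonal matrix with diagonal $a_0,\dots,a_{n-1}$ and off-diagonal $b_0,\dots,b_{n-2}$. The Krylov subspace is $\mathcal K_k=\mathrm{span}\{\vec b,W\vec b,\dots,W^{k-1}\vec b\}$. The $k$-th CGA iterate (with $\vec x_0=0$) is $\vec x_k=\mathrm{argmin}_{\vec y\in\mathcal K_k}\|\vec x-\vec y\|_W$ where $\vec x=W^{-1}\vec b$ and $\|\vec y\|_W^2=\vec y^*W\vec y$; the $k$-th MINRES iterate is $\vec x_k=\mathrm{argmin}_{\vec y\in\mathcal K_k}\|\vec b-W\vec y\|_2$. For either method $\vec r_k=\vec b-W\vec x_k$ and $\vec e_k=\vec x-\vec x_k$. $\vec f_1,\vec f_2,\dots$ is the standard basis; $H_{i:k,j:\ell}$ denotes the submatrix of rows $i..k$ and columns $j..\ell$. *)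

(* Defs.v *)
From HB Require Import structures.
From mathcomp Require Import all_boot all_order all_algebra.
Set Implicit Arguments. Unset Strict Implicit. Unset Printing Implicit Defensive.
Import Order.TTheory GRing.Theory Num.Theory.
Local Open Scope ring_scope.

Section Defs.
Variable C : numClosedFieldType.

Definition dotc N (x y : 'cV[C]_N) : C := \sum_(i < N) (x i 0)^* * y i 0.
Definition norm2 N (x : 'cV[C]_N) : C := sqrtC (dotc x x).
Definition normW N (W : 'M[C]_N) (y : 'cV[C]_N) : C := sqrtC (dotc y (W *m y)).

Definition is_hermitian N (W : 'M[C]_N) := map_mx Num.conj W^T = W.
Definition is_posdef N (W : 'M[C]_N) := forall v : 'cV[C]_N, v != 0 -> 0 < dotc v (W *m v).

(* Lanczos state before step k+1: (q_k, q_{k+1}, b_{k-1}); start (q_0, q_1, b_{-1}) = (0, q1, 1). *)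
Fixpoint lz_state N (W : 'M[C]_N) (q1 : 'cV[C]_N) (k : nat)
  : 'cV[C]_N * 'cV[C]_N * C :=
  match k with
  | 0%N => (0, q1, 1)
  | k'.+1 =>
    let: (qp, q, bp) := lz_state W q1 k' in
    let a := dotc (W *m q - bp *: qp) q in
    let v := W *m q - a *: q - bp *: qp in
    let b := norm2 v in
    (q, b^-1 *: v, b)
  end.

Definition lz_a N (W : 'M[C]_N) q1 (k : nat) : C :=
  let: (qp, q, bp) := lz_state W q1 k in dotc (W *m q - bp *: qp) q.
Definition lz_b N (W : 'M[C]_N) q1 (k : nat) : C := (lz_state W q1 k.+1).2.

Definition lanczos_terminates N (W : 'M[C]_N) q1 (n : nat) :=
  (0 < n)%N /\ lz_b W q1 n.-1 = 0 /\ forall k, (k < n.-1)%N -> lz_b W q1 k != 0.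

Definition jacobi N (W : 'M[C]_N) q1 (n : nat) : 'M[C]_n :=
  \matrix_(i < n, j < n)
    if i == j then lz_a W q1 i
    else if (i == j.+1 :> nat) then lz_b W q1 j
    else if (j == i.+1 :> nat) then lz_b W q1 i
    else 0.

(* entry of a matrix at (0-based) natural indices, 0 outside *)
Definition mxe m n (A : 'M[C]_(m, n)) (i j : nat) : C :=
  match insub i, insub j with
  | Some i', Some j' => A i' j'
  | _, _ => 0
  end.

(* H_{k+1:n, k+1:n} (1-based) *)
Definition trail_submx n (A : 'M[C]_n) (k : nat) : 'M[C]_(n - k) :=
  \matrix_(i < n - k, j < n - k) mxe A (i + k) (j + k).

Definition f1 m : 'cV[C]_m := \col_(i < m) ((i : nat) == 0%N)%:R.

Definition krylov N (W : 'M[C]_N) (b : 'cV[C]_N) (k : nat) (y : 'cV[C]_N) :=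
  exists c : 'I_k -> C, y = \sum_(i < k) c i *: iter i (mulmx W) b.

Definition is_CG_iterate N (W : 'M[C]_N) b k (xk : 'cV[C]_N) :=
  krylov W b k xk /\
  forall y, krylov W b k y ->
    normW W (invmx W *m b - xk) <= normW W (invmx W *m b - y).

Definition is_MINRES_iterate N (W : 'M[C]_N) b k (xk : 'cV[C]_N) :=
  krylov W b k xk /\
  forall y, krylov W b k y -> norm2 (b - W *m xk) <= norm2 (b - W *m y).

End Defs.

(* Main.v *)
Require Import Defs.
From HB Require Import structures.
From mathcomp Require Import all_boot all_order all_algebra.
From mathcomp Require Import ring zify.
Set Implicit Arguments. Unset Strict Implicit. Unset Printing Implicit Defensive.
Import Order.TTheory GRing.Theory Num.Theory.
Local Open Scope ring_scope.

(** Index the Lanczos vectors from 0 and let [p_k] be defined by [q_k = alpha_k p_k + beta_(k-1) p_(k-1)].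
    Since the Jacobi matrix is [H H^T], the three-term recurrence becomes
    [W p_k = alpha_k q_k + beta_k q_(k+1)].  Telescoping from [q_0 = b], the vectors
    [x_k = \sum_(j < k) (rho_j / alpha_j) p_j] with [rho_k = \prod_(j < k) - (beta_j / alpha_j)] have
    residual [rho_k q_k], which is orthogonal to the k-th Krylov space: they are the CG iterates.
    The [p_j] are W-orthonormal, so the squared error is the sum of [(rho_j / alpha_j)^2] over
    [k <= j < n]; divided by [rho_k], these coefficients solve [L_k y = f_1].
    Averaging the CG iterates [x_0, ..., x_k] with weights [rho_j^-2] gives a residual proportional to
    [\sum_(j <= k) rho_j^-1 q_j = (alpha_k / rho_k) p_k], whose image under W is orthogonal to the
    k-th Krylov space: this is the MINRES iterate. *)

(** * The Hermitian inner product and positive definite forms *)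

Section HermitianForm.
Variables (C : numClosedFieldType) (N : nat).
Implicit Types (x y z : 'cV[C]_N) (W : 'M[C]_N) (c : C).

Lemma dotcC x y : dotc y x = (dotc x y)^*.
Proof.
rewrite /dotc rmorph_sum; apply: eq_bigr => i _.
by rewrite rmorphM /= conjCK mulrC.
Qed.

Lemma dotcDr x y z : dotc x (y + z) = dotc x y + dotc x z.
Proof. by rewrite /dotc -big_split; apply: eq_bigr => i _; rewrite !mxE mulrDr. Qed.

Lemma dotcZr x c y : dotc x (c *: y) = c * dotc x y.
Proof. by rewrite /dotc mulr_sumr; apply: eq_bigr => i _; rewrite !mxE mulrCA. Qed.

Lemma dotcNr x y : dotc x (- y) = - dotc x y.
Proof. by rewrite -scaleN1r dotcZr mulN1r. Qed.

Lemma dotc0r x : dotc x 0 = 0.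
Proof. by rewrite -(scale0r 0) dotcZr mul0r. Qed.

Lemma dotcDl x y z : dotc (x + y) z = dotc x z + dotc y z.
Proof. by rewrite dotcC dotcDr rmorphD /= -!dotcC. Qed.

Lemma dotcZl c x y : dotc (c *: x) y = c^* * dotc x y.
Proof. by rewrite dotcC dotcZr rmorphM /= -dotcC. Qed.

Lemma dotcNl x y : dotc (- x) y = - dotc x y.
Proof. by rewrite dotcC dotcNr rmorphN /= -dotcC. Qed.

Lemma dotc0l y : dotc 0 y = 0.
Proof. by rewrite dotcC dotc0r conjC0. Qed.

Lemma dotc_suml (I : finType) (F : I -> 'cV[C]_N) y :
  dotc (\sum_i F i) y = \sum_i dotc (F i) y.
Proof. by elim/big_rec2: _ => [|i u v _ <-]; rewrite ?dotc0l ?dotcDl. Qed.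

Lemma dotc_ge0 x : 0 <= dotc x x.
Proof. by apply: sumr_ge0 => i _; rewrite mulrC -normCK exprn_ge0. Qed.

Lemma dotc_eq0 x : dotc x x = 0 -> x = 0.
Proof.
move=> /eqP; rewrite psumr_eq0 => [|i _]; last by rewrite mulrC -normCK exprn_ge0.
move=> /allP h; apply/matrixP => i j; rewrite ord1 mxE.
have := h i (mem_index_enum _); rewrite mulrC -normCK sqrf_eq0 normr_eq0.
by move/eqP.
Qed.

Lemma norm2_sqr x : norm2 x ^+ 2 = dotc x x.
Proof. exact: sqrtCK. Qed.

Lemma norm2_ge0 x : 0 <= norm2 x.
Proof. by rewrite sqrtC_ge0 dotc_ge0. Qed.

Lemma norm2_eq0 x : norm2 x = 0 -> x = 0.
Proof. by move=> h; apply: dotc_eq0; rewrite -norm2_sqr h expr0n. Qed.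

Lemma norm2Z c x : 0 <= c -> norm2 (c *: x) = c * norm2 x.
Proof.
move=> c0; rewrite /norm2 dotcZl dotcZr mulrA (conj_Creal (ger0_real c0)) -expr2.
by rewrite rootCMl ?exprn_ge0 // sqrCK.
Qed.

Lemma dotc_herm W x y : is_hermitian W -> dotc x (W *m y) = dotc (W *m x) y.
Proof.
move=> hW; rewrite /dotc.
under eq_bigr do rewrite mxE mulr_sumr.
under [RHS]eq_bigr do rewrite mxE rmorph_sum mulr_suml.
rewrite exchange_big; apply: eq_bigr => i _; apply: eq_bigr => j _.
have -> : W j i = (W i j)^* by rewrite -[in LHS]hW !mxE.
by rewrite rmorphM /= mulrA [_^* * _^*]mulrC.
Qed.

Lemma dotc_pythagoras {W x y} : is_hermitian W -> dotc y (W *m x) = 0 ->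
  dotc (x + y) (W *m (x + y)) = dotc x (W *m x) + dotc y (W *m y).
Proof.
move=> hW xy0; rewrite mulmxDr !dotcDl !dotcDr xy0 [dotc x (W *m y)]dotc_herm //.
by rewrite [dotc (W *m x) y]dotcC xy0 conjC0 addr0 add0r.
Qed.

(** With the identity as [W], [dotc_pythagoras] becomes the Euclidean statement behind MINRES. *)
Lemma hermitian1 : is_hermitian (1%:M : 'M[C]_N).
Proof. by rewrite /is_hermitian trmx1 map_mx1. Qed.

Lemma posdef_ge0 W x : is_posdef W -> 0 <= dotc x (W *m x).
Proof. by move=> hW; have [->|/hW/ltW//] := eqVneq x 0; rewrite dotc0l. Qed.

Lemma posdef_eq0 W x : is_posdef W -> dotc x (W *m x) = 0 -> x = 0.
Proof. by move=> hW h; apply/eqP/contraT => /hW; rewrite h ltxx. Qed.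

Lemma posdef_unit W : is_posdef W -> W \in unitmx.
Proof.
move=> hW; rewrite -unitmx_tr -row_free_unit -kermx_eq0; apply/eqP/row_matrixP => i.
rewrite row0; apply: trmx_inj; rewrite trmx0; apply: (posdef_eq0 (W := W)) => //.
have -> : W *m (row i (kermx W^T))^T = (row i (kermx W^T) *m W^T)^T.
  by rewrite trmx_mul trmxK.
by rewrite -row_mul mulmx_ker row0 trmx0 dotc0r.
Qed.

End HermitianForm.

(** * Closure properties of the Krylov spaces *)

Section Krylov.
Variables (C : numClosedFieldType) (N : nat) (W : 'M[C]_N) (b : 'cV[C]_N).
Implicit Types (x y : 'cV[C]_N) (k : nat).
Notation K := (krylov W b).

Lemma krylov0 k : K k 0.
Proof. by exists (fun=> 0); rewrite big1 // => i _; rewrite scale0r. Qed.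

Lemma krylovD {k x y} : K k x -> K k y -> K k (x + y).
Proof.
move=> [c ->] [d ->]; exists (fun i => c i + d i); rewrite -big_split.
by apply: eq_bigr => i _; rewrite scalerDl.
Qed.

Lemma krylovZ {k} c {x} : K k x -> K k (c *: x).
Proof.
move=> [d ->]; exists (fun i => c * d i); rewrite scaler_sumr.
by apply: eq_bigr => i _; rewrite scalerA.
Qed.

Lemma krylovB {k x y} : K k x -> K k y -> K k (x - y).
Proof. by move=> hx hy; rewrite -scaleN1r; apply/krylovD/krylovZ. Qed.

Lemma krylov_sum k m (F : 'I_m -> 'cV[C]_N) :
  (forall i, K k (F i)) -> K k (\sum_(i < m) F i).
Proof. by move=> h; apply: big_ind => //; [apply: krylov0 | move=> ? ? /krylovD]; apply. Qed.

Lemma krylov_iter k i : (i < k)%N -> K k (iter i (mulmx W) b).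
Proof.
move=> ik; exists (fun j => ((j : nat) == i)%:R).
rewrite (bigD1 (Ordinal ik)) //= eqxx scale1r big1 ?addr0 // => j /negPf nj.
by rewrite -val_eqE /= in nj; rewrite nj scale0r.
Qed.

Lemma krylov_le {k} m {x} : (k <= m)%N -> K k x -> K m x.
Proof.
move=> km [c ->]; apply: krylov_sum => i; apply/krylovZ/krylov_iter.
exact: leq_trans (ltn_ord i) km.
Qed.

Lemma krylov_mul {k x} : K k x -> K k.+1 (W *m x).
Proof.
move=> [c ->]; rewrite mulmx_sumr; apply: krylov_sum => i.
by rewrite -scalemxAr; apply/krylovZ/(@krylov_iter _ i.+1); rewrite ltnS.
Qed.

End Krylov.

(** * The three-term Lanczos recurrence *)

Section Lanczos.
Variables (C : numClosedFieldType) (N : nat) (W : 'M[C]_N) (b : 'cV[C]_N).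
Hypothesis hW : is_hermitian W.
Notation la := (lz_a W b).
Notation lb := (lz_b W b).

(* [lz_q k] is the paper's q_{k+1}, locked so that matching does not unfold [lz_state]. *)
Definition lz_q k := locked (lz_state W b k).1.2.
Notation q := lz_q.

Lemma lz_q0 : q 0 = b. Proof. by rewrite /q -lock. Qed.

Lemma lz_state_prevq k : (lz_state W b k.+1).1.1 = q k.
Proof. by rewrite /q -!lock /=; case: (lz_state W b k) => [[]]. Qed.

(* At breakdown the norm vanishes together with the vector, so the relation needs no side condition. *)
Lemma lz_rec_state k :
  W *m q k = lb k *: q k.+1 + la k *: q k + (lz_state W b k).2 *: (lz_state W b k).1.1.
Proof.
rewrite /lz_b /lz_a /q -!lock /=; case: (lz_state W b k) => [[qp q'] bp] /=.
set v := _ - _ - _; have vE : norm2 v *: ((norm2 v)^-1 *: v) = v.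
  have [/[dup] /norm2_eq0 -> _|v0] := eqVneq (norm2 v) 0; first by rewrite !scaler0.
  by rewrite scalerA divff // scale1r.
by rewrite vE /v addrAC !subrK.
Qed.

Lemma lz_rec0 : W *m q 0 = lb 0 *: q 1 + la 0 *: q 0.
Proof. by rewrite lz_rec_state /= scaler0 addr0. Qed.

Lemma lz_recS k : W *m q k.+1 = lb k.+1 *: q k.+2 + la k.+1 *: q k.+1 + lb k *: q k.
Proof. by rewrite lz_rec_state lz_state_prevq. Qed.

Lemma lz_b_ge0 k : 0 <= lb k.
Proof. by rewrite /lz_b /=; case: (lz_state W b k) => [[qp q'] bp] /=; exact: norm2_ge0. Qed.

Lemma lz_aE k : la k =
  dotc (W *m q k - (lz_state W b k).2 *: (lz_state W b k).1.1) (q k).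
Proof. by rewrite /lz_a /q -lock; case: (lz_state W b k) => [[]]. Qed.

Lemma lz_bqE k : lb k *: q k.+1 =
  W *m q k - la k *: q k - (lz_state W b k).2 *: (lz_state W b k).1.1.
Proof. by rewrite lz_rec_state addrAC !addrK. Qed.

Lemma lz_norm_bq k : lb k != 0 -> dotc (q k.+1) (q k.+1) = 1.
Proof.
rewrite /lz_b /q -!lock /=; case: (lz_state W b k) => [[qp q'] bp] /= h.
set v := _ - _ - _ in h *.
rewrite dotcZl dotcZr -norm2_sqr conj_Creal ?rpredV ?ger0_real ?norm2_ge0 //.
by field.
Qed.

Lemma lz_q_krylov k : krylov W b k.+1 (q k).
Proof.
(* The recurrence reaches back two vectors, so the induction carries the previous one along. *)
suff: krylov W b k.+1 (q k) /\ krylov W b k.+1 (lz_state W b k).1.1 by case.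
elim: k => [|k [IHq IHp]].
  by split; [rewrite lz_q0; apply: (@krylov_iter _ _ _ _ 1 0) | apply: krylov0].
split; last by rewrite lz_state_prevq; apply: krylov_le IHq.
(* This also holds at breakdown: there [0^-1 = 0] makes [q k.+1] the zero vector. *)
have -> : q k.+1 = (lb k)^-1 *: (lb k *: q k.+1).
  have [b0|b0] := eqVneq (lb k) 0; last by rewrite scalerA mulVf // scale1r.
  rewrite b0 scale0r scaler0; move: b0; rewrite /lz_b /q -!lock /=.
  by case: (lz_state W b k) => [[qp q'] bp] /= ->; rewrite invr0 scale0r.
rewrite lz_bqE; apply/krylovZ/krylovB; last by apply/krylovZ/(krylov_le _ IHp).
by apply: krylovB; [apply: krylov_mul | apply/krylovZ/(krylov_le _ IHq)].
Qed.

(** * Orthonormality of the Lanczos vectors up to termination *)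

Section Orthogonality.
Variable n : nat.
Hypothesis b1 : norm2 b = 1.
Hypothesis lzT : lanczos_terminates W b n.

Lemma lz_b_gt0 k : (k.+1 < n)%N -> 0 < lb k.
Proof.
move=> kn; rewrite lt_def lz_b_ge0 andbT; apply: (proj2 (proj2 lzT)).
by case: n kn.
Qed.

Lemma lz_orthonormal i j : (i < n)%N -> (j < n)%N -> dotc (q i) (q j) = (i == j)%:R.
Proof.
suff orth m : (m < n)%N -> forall i j, (i <= m)%N -> (j <= m)%N ->
    dotc (q i) (q j) = (i == j)%:R.
  move=> lin ljn; apply: (orth (maxn i j)); rewrite ?leq_maxl ?leq_maxr //.
  by rewrite gtn_max lin ljn.
elim: m => [|m IH] mn {}i {}j.
  by rewrite !leqn0 => /eqP -> /eqP ->; rewrite lz_q0 -norm2_sqr b1 expr1n.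
have {}IH := IH (ltnW mn).
have b0 := lz_b_gt0 mn.
have lb_real k : (lb k)^* = lb k by apply/conj_Creal/ger0_real/lz_b_ge0.
(* Since [lb m] is nonzero, it suffices to test the unnormalized vector [lb m *: q m.+1] against
   [q l]. *)
have new l : (l <= m)%N -> dotc (q l) (q m.+1) = 0.
  move=> lm; apply: (mulfI (lt0r_neq0 b0)); rewrite mulr0 -dotcZr lz_bqE.
  rewrite !dotcDr !dotcNr !dotcZr (dotc_herm _ _ hW) IH //.
  have [->|lNm] := eqVneq l m.
    (* The choice of [la m] removes the component along [q m]. The case [m = 0] is apart because the
       previous vector is then 0. *)
    rewrite lz_aE dotcDl dotcNl dotcZl; case: m IH {mn b0 l lm} => [|m] IH.
      by rewrite /= dotc0r dotc0l; ring.
    by rewrite lz_state_prevq !IH // (ltn_eqF (ltnSn m)) (gtn_eqF (ltnSn m)) /=; ring.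
  (* For [l < m], expanding [W *m q l] leaves only its coefficient on [q m], present when
     [l.+1 = m]; the term subtracted for the previous vector cancels it. *)
  have {}lm : (l < m)%N by rewrite ltn_neqAle lNm.
  case: m IH lm {mn b0 lNm} => // m IH lm.
  rewrite lz_state_prevq (IH l m) ?leqnSn //; last exact: ltnW.
  rewrite /= -/(lb m); case: l lm => [|l] lm.
    rewrite lz_rec0 !dotcDl !dotcZl lb_real !IH // eqSS.
    by have [<-|_] := eqVneq 0%N m => /=; ring.
  rewrite lz_recS !dotcDl !dotcZl !lb_real !IH ?(ltnW lm) // ?eqSS; last by lia.
  have /negPf -> : l != m.+1 by lia.
  have /negPf -> : l != m by lia.
  by have [<-|_] := eqVneq l.+1 m => /=; ring.
rewrite leq_eqVlt => /predU1P[->|im]; rewrite leq_eqVlt => /predU1P[->|jm].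
- by rewrite eqxx lz_norm_bq ?lt0r_neq0.
- by rewrite dotcC new // conjC0 gtn_eqF.
- by rewrite new // ltn_eqF.
exact: IH.
Qed.

Lemma lz_b_last k : k.+1 = n -> lb k = 0.
Proof. by move=> kn; rewrite -(proj1 (proj2 lzT)) -kn. Qed.

(* [W] is moved onto [q m] and the three-term recurrence is applied there. *)
Lemma iter_mul_orth i m : (i < m)%N -> (m < n)%N -> dotc (iter i (mulmx W) b) (q m) = 0.
Proof.
elim: i m => [|i IH] m.
  move=> m0 mn; have n0 : (0 < n)%N by lia.
  by rewrite /= -lz_q0 lz_orthonormal // ltn_eqF.
case: m => // m im mn; rewrite /= -(dotc_herm _ _ hW) lz_recS !dotcDr !dotcZr.
rewrite (IH m) ?(IH m.+1) ?mulr0 ?addr0; try lia.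
(* If [m.+2 = n], the induction hypothesis does not reach [q m.+2], but its coefficient is the
   vanishing last [lb]. *)
have [/lz_b_last ->|mN] := eqVneq m.+2 n; first by rewrite mul0r.
by rewrite IH ?mulr0 //; lia.
Qed.

Lemma krylov_orth k m y : krylov W b k y -> (k <= m < n)%N -> dotc y (q m) = 0.
Proof.
move=> [c ->] /andP[km mn]; rewrite dotc_suml big1 // => i _.
by rewrite dotcZl iter_mul_orth ?mulr0 // (leq_trans _ km).
Qed.

End Orthogonality.
End Lanczos.

(** * Both minimizers characterized by orthogonality of the residual *)

Section Projection.
Variables (C : numClosedFieldType) (N : nat) (W : 'M[C]_N) (b : 'cV[C]_N).
Hypotheses (hW : is_hermitian W) (pW : is_posdef W).
Implicit Types x y : 'cV[C]_N.

(** For [y] in the Krylov space, [x - y] lies there too, so the cross term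
    [dotc (x - y) (b - W *m x)] vanishes and the squared error of [y] exceeds that of [x] by the
    squared [W]-norm of [x - y]. Definiteness then gives uniqueness. *)
Lemma CG_iterate_uniq k x :
  krylov W b k x -> (forall y, krylov W b k y -> dotc y (b - W *m x) = 0) ->
  forall y, is_CG_iterate W b k y <-> y = x.
Proof.
move=> xK orth.
have WiW : W *m (invmx W *m b) = b by rewrite mulKVmx ?posdef_unit.
pose F y := dotc (invmx W *m b - y) (W *m (invmx W *m b - y)).
have FE y : krylov W b k y -> F y = F x + dotc (x - y) (W *m (x - y)).
  move=> yK; rewrite /F -(dotc_pythagoras (W := W)) ?addrA ?subrK //.
  by rewrite mulmxBr WiW orth //; apply: krylovB.
move=> y; split=> [[yK ymin]|->].
  have := ymin x xK; rewrite /normW ler_sqrtC ?nnegrE ?posdef_ge0 // -/(F y) -/(F x) (FE y yK).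
  rewrite gerDl => le0; apply/esym/eqP; rewrite -subr_eq0; apply/eqP/(posdef_eq0 pW).
  by apply/le_anti; rewrite le0 posdef_ge0.
split=> // z zK; rewrite /normW ler_sqrtC ?nnegrE ?posdef_ge0 // -/(F z) -/(F x) (FE z zK).
by rewrite lerDl posdef_ge0.
Qed.

(** The same argument in the Euclidean norm, with excess the squared norm of [W *m (x - y)];
    uniqueness now comes from invertibility of [W]. *)
Lemma MINRES_iterate_uniq k x :
  krylov W b k x -> (forall y, krylov W b k y -> dotc (W *m y) (b - W *m x) = 0) ->
  forall y, is_MINRES_iterate W b k y <-> y = x.
Proof.
move=> xK orth; pose F y := dotc (b - W *m y) (b - W *m y).
have FE y : krylov W b k y -> F y = F x + dotc (W *m (x - y)) (W *m (x - y)).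
  move=> yK; have /(dotc_pythagoras (hermitian1 _ _)) :
      dotc (W *m (x - y)) (1%:M *m (b - W *m x)) = 0.
    by rewrite mul1mx orth //; apply: krylovB.
  by rewrite !mul1mx /F mulmxBr addrA subrK.
move=> y; split=> [[yK ymin]|->].
  have := ymin x xK; rewrite /norm2 ler_sqrtC ?nnegrE ?dotc_ge0 // -/(F y) -/(F x) (FE y yK).
  rewrite gerDl => le0; apply/esym/eqP; rewrite -subr_eq0; apply/eqP.
  have /dotc_eq0 Wxy0 : dotc (W *m (x - y)) (W *m (x - y)) = 0.
    by apply/le_anti; rewrite le0 dotc_ge0.
  by rewrite -[x - y](mulKmx (posdef_unit pW)) Wxy0 mulmx0.
split=> // z zK; rewrite /norm2 ler_sqrtC ?nnegrE ?dotc_ge0 // -/(F z) -/(F x) (FE z zK).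
by rewrite lerDl dotc_ge0.
Qed.

End Projection.

(** * CG and MINRES iterates from the bidiagonal coefficients *)

Section BidiagonalFactor.
Variables (C : numClosedFieldType) (N : nat) (W : 'M[C]_N) (b : 'cV[C]_N) (n : nat).
Hypotheses (hW : is_hermitian W) (pW : is_posdef W) (b1 : norm2 b = 1).
Hypothesis lzT : lanczos_terminates W b n.
Notation la := (lz_a W b).
Notation lb := (lz_b W b).
Notation q := (lz_q W b).
Variables al be : nat -> C.
Hypothesis al_gt0 : forall k, (k < n)%N -> 0 < al k.
Hypothesis lbE : forall k, (k < n)%N -> lb k = al k * be k.
Hypothesis la0E : la 0 = al 0 ^+ 2.
Hypothesis laSE : forall k, (k.+1 < n)%N -> la k.+1 = al k.+1 ^+ 2 + be k ^+ 2.

Lemma al_neq0 k : (k < n)%N -> al k != 0.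
Proof. by move=> kn; rewrite gt_eqF ?al_gt0. Qed.

Lemma be_gt0 k : (k.+1 < n)%N -> 0 < be k.
Proof.
move=> kn; have := lz_b_gt0 lzT kn; rewrite lbE ?(ltnW kn) //.
by rewrite pmulr_rgt0 ?al_gt0 ?(ltnW kn).
Qed.

Lemma be_neq0 k : (k.+1 < n)%N -> be k != 0.
Proof. by move=> kn; rewrite gt_eqF ?be_gt0. Qed.

(** As [lbE] includes [k = n - 1], the Lanczos breakdown passes to [be]. This makes [rho n] vanish
    and absorbs every term in [q n]. *)
Lemma be_last k : k.+1 = n -> be k = 0.
Proof.
move=> kn; have kn' : (k < n)%N by rewrite -kn.
have := lz_b_last lzT kn; rewrite lbE // => /eqP.
by rewrite mulf_eq0 (negPf (al_neq0 kn')) => /eqP.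
Qed.

(* With Q and P the matrices of columns [lz_q] and [cg_dir], P H^T = Q. *)
Fixpoint cg_dir k : 'cV[C]_N :=
  if k is k'.+1 then (al k)^-1 *: (q k - be k' *: cg_dir k') else (al 0)^-1 *: q 0.
Notation p := cg_dir.

Lemma lz_q_dir0 : (0 < n)%N -> q 0 = al 0 *: p 0.
Proof. by move=> n0; rewrite /= scalerA divff ?al_neq0 // scale1r. Qed.

Lemma lz_q_dirS k : (k.+1 < n)%N -> q k.+1 = al k.+1 *: p k.+1 + be k *: p k.
Proof. by move=> kn; rewrite /= scalerA divff ?al_neq0 // scale1r subrK. Qed.

(** In matrix form this is [W P = Q H], that is, [W Q = Q H H^T] with [H^T] cancelled through
    [P H^T = Q]. The induction performs the cancellation column by column. *)
Lemma mul_cg_dir k : (k < n)%N -> W *m p k = al k *: q k + be k *: q k.+1.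
Proof.
elim: k => [|k IH] kn.
  rewrite /= -scalemxAr lz_rec0 lbE // la0E; have := al_neq0 kn => ?.
  by apply/matrixP => i j; rewrite !mxE; field.
rewrite [p _]/= -scalemxAr mulmxBr -scalemxAr IH ?(ltnW kn) // lz_recS !lbE ?(ltnW kn) // laSE //.
have := al_neq0 kn => ?.
by apply/matrixP => i j; rewrite !mxE; field.
Qed.

Lemma cg_dir_krylov k : krylov W b k.+1 (p k).
Proof.
elim: k => [|k IH]; first exact/krylovZ/lz_q_krylov.
apply/krylovZ/krylovB; first exact: lz_q_krylov.
exact/krylovZ/(krylov_le _ IH).
Qed.

Lemma al_conj k : (k < n)%N -> (al k)^* = al k.
Proof. by move=> kn; apply/conj_Creal/gtr0_real/al_gt0. Qed.

(** Only the leading term of [p k] meets [q k]: the preceding direction lies in the k-th Krylov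
    space. *)
Lemma dotc_cg_dir k : (k < n)%N -> dotc (p k) (q k) = (al k)^-1.
Proof.
case: k => [|k] kn.
  by rewrite [p _]/= dotcZl fmorphV /= al_conj // (lz_orthonormal hW b1 lzT) // mulr1.
rewrite [p _]/= dotcZl fmorphV /= al_conj // dotcDl dotcNl dotcZl.
rewrite (lz_orthonormal hW b1 lzT) // (krylov_orth hW b1 lzT (cg_dir_krylov k)) ?leqnn //.
by rewrite eqxx mulr0 subr0 mulr1.
Qed.

(* [cg_coef k] is, up to sign, the norm of the k-th CG residual. *)
Definition cg_coef k : C := \prod_(j < k) - (be j / al j).
Notation rho := cg_coef.

Lemma cg_coef0 : rho 0 = 1.
Proof. by rewrite /rho big_ord0. Qed.

Lemma cg_coefS k : rho k.+1 = - (rho k * be k / al k).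
Proof. by rewrite /rho big_ord_recr /= mulrN mulrA. Qed.

Lemma cg_coef_sqr k : rho k ^+ 2 = (\prod_(j < k) (be j / al j)) ^+ 2.
Proof. by rewrite -!prodrXl; apply: eq_bigr => j _; rewrite sqrrN. Qed.

Lemma cg_coef_last : rho n = 0.
Proof.
case: (n) (proj1 lzT) (@be_last) => // m _ be0.
by rewrite cg_coefS be0 // mulr0 mul0r oppr0.
Qed.

Lemma cg_prod_gt0 k : (k < n)%N -> 0 < \prod_(j < k) (be j / al j).
Proof.
move=> kn; apply: prodr_gt0 => j _; have := ltn_ord j => jk.
by rewrite divr_gt0 ?be_gt0 ?al_gt0 //; lia.
Qed.

Lemma cg_coef_neq0 k : (k < n)%N -> rho k != 0.
Proof.
move=> kn; rewrite -sqrf_eq0 cg_coef_sqr sqrf_eq0.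
by rewrite gt_eqF ?cg_prod_gt0.
Qed.

Lemma cg_coef_conj k : (k <= n)%N -> (rho k)^* = rho k.
Proof.
rewrite leq_eqVlt => /predU1P[->|kn]; first by rewrite cg_coef_last conjC0.
rewrite /rho rmorph_prod; apply: eq_bigr => j _; have := ltn_ord j => jk.
rewrite rmorphN rmorphM fmorphV /= al_conj; last by lia.
by rewrite conj_Creal // gtr0_real // be_gt0; lia.
Qed.

Definition cg_iterate k : 'cV[C]_N := \sum_(j < k) (rho j / al j) *: p j.

Lemma cg_iterateS k : cg_iterate k.+1 = cg_iterate k + (rho k / al k) *: p k.
Proof. by rewrite /cg_iterate big_ord_recr. Qed.

Lemma cg_iterate_krylov k : krylov W b k (cg_iterate k).
Proof.
apply: krylov_sum => j; apply/krylovZ; apply: krylov_le (cg_dir_krylov j).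
exact: ltn_ord.
Qed.

(** Adding the direction [p k] cancels [rho k *: q k] and leaves a multiple of [q k.+1], which
    defines [rho k.+1]. *)
Lemma cg_residual k : (k <= n)%N -> b - W *m cg_iterate k = rho k *: q k.
Proof.
elim: k => [|k IH] kn.
  by rewrite /cg_iterate big_ord0 mulmx0 subr0 cg_coef0 scale1r lz_q0.
rewrite cg_iterateS mulmxDr opprD addrA IH ?(ltnW kn) // -scalemxAr mul_cg_dir // cg_coefS.
have := al_neq0 kn => ?.
by apply/matrixP => i j; rewrite !mxE; field.
Qed.

Lemma mul_cg_iterate_last : W *m cg_iterate n = b.
Proof.
by apply/esym/eqP; rewrite -subr_eq0 cg_residual // cg_coef_last scale0r.
Qed.

Lemma CG_iterateP k x : (k < n)%N -> is_CG_iterate W b k x <-> x = cg_iterate k.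
Proof.
move=> kn; apply: CG_iterate_uniq => //; first exact: cg_iterate_krylov.
move=> y yK; rewrite cg_residual ?(ltnW kn) // dotcZr.
by rewrite (krylov_orth hW b1 lzT yK) ?leqnn // mulr0.
Qed.

Lemma norm2_cg_residual k : (k < n)%N ->
  norm2 (b - W *m cg_iterate k) = \prod_(j < k) (be j / al j).
Proof.
move=> kn; rewrite cg_residual ?(ltnW kn) // /norm2 dotcZl dotcZr.
rewrite (lz_orthonormal hW b1 lzT) // eqxx mulr1 cg_coef_conj ?(ltnW kn) // -expr2.
by rewrite cg_coef_sqr sqrCK ?ltW ?cg_prod_gt0.
Qed.

(** The exact solution is [cg_iterate n]; descending from [n], each step splits off one more
    [W]-orthogonal direction by Pythagoras. *)
Lemma cg_error_sqr k : (k <= n)%N ->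
  dotc (invmx W *m b - cg_iterate k) (W *m (invmx W *m b - cg_iterate k)) =
  \sum_(i < n - k) (rho (i + k) / al (i + k)) ^+ 2.
Proof.
have -> : invmx W *m b = cg_iterate n by rewrite -mul_cg_iterate_last mulKmx ?posdef_unit.
move mE: (n - k)%N => m; elim: m k mE => [|m IH] k mE kn.
  have -> : k = n by lia.
  by rewrite subrr dotc0l big_ord0.
have {}kn : (k < n)%N by lia.
have -> : cg_iterate n - cg_iterate k =
    cg_iterate n - cg_iterate k.+1 + (rho k / al k) *: p k.
  by rewrite cg_iterateS opprD addrA subrK.
rewrite (dotc_pythagoras hW).
  rewrite IH //; last by lia.
  rewrite big_ord_recl addrC /=; congr (_ + _).
    (* The directions have unit [W]-norm: [W *m p k] pairs with [p k] only through [al k *: q k]. *)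
    rewrite -scalemxAr mul_cg_dir // dotcZl dotcZr dotcDr !dotcZr dotc_cg_dir //.
    have -> : be k * dotc (p k) (q k.+1) = 0.
      have [/be_last ->|kN] := eqVneq k.+1 n; first by rewrite mul0r.
      by rewrite (krylov_orth hW b1 lzT (cg_dir_krylov k)) ?mulr0 //; lia.
    rewrite addr0 divff ?al_neq0 // rmorphM fmorphV /= al_conj // cg_coef_conj ?(ltnW kn) //.
    by rewrite mulr1 -expr2.
  by apply: eq_bigr => i _; rewrite -addSnnS.
(* The cross term pairs [p k] with the residual of [cg_iterate k.+1], a multiple of [q k.+1]. *)
rewrite mulmxBr mul_cg_iterate_last cg_residual // dotcZl dotcZr.
have [->|kN] := eqVneq k.+1 n; first by rewrite cg_coef_last mul0r mulr0.
by rewrite (krylov_orth hW b1 lzT (cg_dir_krylov k)) ?mulr0 //; lia.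
Qed.

(** Each summand equals the product of [al l ^+ 2 / be l ^+ 2] over [l < j], so this is the sum in
    the MINRES formula. *)
Definition minres_weight k : C := \sum_(j < k.+1) (rho j ^+ 2)^-1.
Notation S := minres_weight.

Lemma minres_weight_gt0 k : (k < n)%N -> 0 < S k.
Proof.
move=> kn; rewrite /S big_ord_recl cg_coef0 expr1n invr1 ltr_pwDl //.
apply: sumr_ge0 => j _; rewrite invr_ge0 cg_coef_sqr exprn_ge0 // ltW // cg_prod_gt0 //.
by rewrite lift0; have := ltn_ord j; lia.
Qed.

Definition minres_iterate k : 'cV[C]_N :=
  (S k)^-1 *: \sum_(j < k.+1) (rho j ^+ 2)^-1 *: cg_iterate j.

Lemma minres_iterate_krylov k : krylov W b k (minres_iterate k).
Proof.
apply/krylovZ/krylov_sum => j; apply/krylovZ.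
by apply: krylov_le (cg_iterate_krylov j); have := ltn_ord j.
Qed.

Lemma minres_residual k : (k < n)%N ->
  b - W *m minres_iterate k = (S k)^-1 *: \sum_(j < k.+1) (rho j)^-1 *: q j.
Proof.
move=> kn; have S0 : S k != 0 by rewrite gt_eqF ?minres_weight_gt0.
(* The weights sum to [S k], so [b] is its own weighted average and the residual is the average of
   the CG residuals. *)
have {1}-> : b = (S k)^-1 *: \sum_(j < k.+1) (rho j ^+ 2)^-1 *: b.
  by rewrite -scaler_suml scalerA mulVf // scale1r.
rewrite /minres_iterate -scalemxAr -scalerBr mulmx_sumr -sumrB; congr (_ *: _).
apply: eq_bigr => j _; have jn : (j < n)%N by have := ltn_ord j; lia.
rewrite -scalemxAr -scalerBr cg_residual ?(ltnW jn) // scalerA; congr (_ *: _).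
by have := cg_coef_neq0 jn => ?; field.
Qed.

(** The new [q k.+1] splits along [p k.+1] and [p k]; the sign in [rho k.+1] makes the [p k] parts
    cancel. *)
Lemma sum_cg_coef_inv k : (k < n)%N ->
  \sum_(j < k.+1) (rho j)^-1 *: q j = (al k / rho k) *: p k.
Proof.
elim: k => [|k IH] kn.
  by rewrite big_ord1 cg_coef0 invr1 scale1r mulr1 lz_q_dir0.
have qE := lz_q_dirS kn; move: (p k.+1) qE => P qE.
rewrite big_ord_recr /= IH ?(ltnW kn) // qE cg_coefS.
have := al_neq0 kn => ?; have := al_neq0 (ltnW kn) => ?; have := be_neq0 kn => ?.
have := cg_coef_neq0 (ltnW kn) => ?.
apply/matrixP => i j; rewrite !mxE; field.
by apply/and3P.
Qed.

Lemma MINRES_iterateP k x : (k < n)%N -> is_MINRES_iterate W b k x <-> x = minres_iterate k.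
Proof.
move=> kn; apply: MINRES_iterate_uniq => //; first exact: minres_iterate_krylov.
move=> y yK; rewrite minres_residual // sum_cg_coef_inv // -(dotc_herm _ _ hW).
rewrite -!scalemxAr mul_cg_dir // !dotcZr dotcDr !dotcZr.
rewrite (krylov_orth hW b1 lzT yK) ?leqnn // mulr0 add0r.
have [/be_last ->|kN] := eqVneq k.+1 n; first by rewrite mul0r !mulr0.
by rewrite (krylov_orth hW b1 lzT yK) ?mulr0 //; lia.
Qed.

Lemma norm2_minres_residual k : (k < n)%N ->
  norm2 (b - W *m minres_iterate k) = (sqrtC (S k))^-1.
Proof.
move=> kn; have S0 := minres_weight_gt0 kn; rewrite minres_residual //.
rewrite norm2Z ?invr_ge0 ?ltW //.
(* By orthonormality the squared norm of this sum is [S k] again, so the residual norm is [S k] to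
   the power -1/2. *)
have -> : norm2 (\sum_(j < k.+1) (rho j)^-1 *: q j) = sqrtC (S k).
  rewrite /norm2 dotc_suml; congr sqrtC; apply: eq_bigr => j _.
  have jn : (j < n)%N by have := ltn_ord j; lia.
  rewrite dotcC dotc_suml (bigD1 j) //= big1 => [|i ij]; last first.
    rewrite dotcZl dotcZr (lz_orthonormal hW b1 lzT) //; last by have := ltn_ord i; lia.
    by rewrite val_eqE (negPf ij) !mulr0.
  rewrite addr0 -dotcC dotcZl dotcZr (lz_orthonormal hW b1 lzT) // eqxx mulr1.
  by rewrite fmorphV /= cg_coef_conj ?(ltnW jn) // -expr2 exprVn.
by rewrite -{1}[S k]sqrtCK expr2 invfM mulfVK // sqrtC_eq0 gt_eqF.
Qed.

(** The residual of [cg_iterate n] is zero, hence orthogonal to everything. *)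
Lemma MINRES_iterate_lastP x : is_MINRES_iterate W b n x <-> x = cg_iterate n.
Proof.
apply: MINRES_iterate_uniq => //; first exact: cg_iterate_krylov.
by move=> y _; rewrite mul_cg_iterate_last subrr dotc0r.
Qed.

End BidiagonalFactor.

(** * Entries of [H H^T] and the trailing blocks of [H] *)

Section Bidiagonal.
Variables (C : numClosedFieldType) (n : nat) (H : 'M[C]_n).
Hypothesis Hbid : forall i j : 'I_n, (i : nat) != j -> (i : nat) != j.+1 -> H i j = 0.
Hypothesis Hpos : forall i : 'I_n, 0 < H i i.

Lemma mxe_ord (i j : 'I_n) : mxe H i j = H i j.
Proof. by rewrite /mxe !valK. Qed.

Lemma mxe_bidiag i j : i != j -> i != j.+1 -> mxe H i j = 0.
Proof.
move=> ij ij1; rewrite /mxe; case: insubP => [i' _ iE|//]; case: insubP => [j' _ jE|//].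
by apply: Hbid; rewrite /= iE jE.
Qed.

(** This makes the subdiagonal entry of index [n - 1] zero, in accordance with the Lanczos
    breakdown. *)
Lemma mxe_row_out i j : (n <= i)%N -> mxe H i j = 0.
Proof. by move=> ni; rewrite /mxe insubN // -leqNgt. Qed.

Lemma mxe_diag_gt0 k : (k < n)%N -> 0 < mxe H k k.
Proof. by move=> kn; rewrite -[k]/(val (Ordinal kn)) mxe_ord. Qed.

(* Only the columns [i] and [i - 1] contribute to a row of a bidiagonal matrix. *)
Lemma bidiag_rowS (m d : nat) (F : nat -> C) (i : 'I_m) : (0 < i)%N ->
  \sum_(l < m) mxe H (i + d) (l + d) * F l =
  mxe H (i + d) (i + d) * F i + mxe H (i + d) (i.-1 + d) * F i.-1.
Proof.
move=> i0; have im : (i.-1 < m)%N by have := ltn_ord i; lia.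
rewrite (bigD1 i) //= (bigD1 (Ordinal im)) /=; last by rewrite -val_eqE /=; lia.
rewrite big1 ?addr0 // => j /andP[]; rewrite -!val_eqE /= => ji ji1.
by rewrite mxe_bidiag ?mul0r //; lia.
Qed.

Lemma bidiag_row0 (m d : nat) (F : nat -> C) : (0 < m)%N ->
  \sum_(l < m) mxe H d (l + d) * F l = mxe H d d * F 0%N.
Proof.
case: m => // m _; rewrite big_ord_recl big1 ?addr0 // => j _.
by rewrite lift0 mxe_bidiag ?mul0r //; lia.
Qed.

(** The form [l + 0] fits [bidiag_row0] and [bidiag_rowS] at [d = 0]. *)
Lemma gram_entry (i j : 'I_n) :
  (H *m H^T) i j = \sum_(l < n) mxe H i (l + 0) * mxe H j l.
Proof.
by rewrite mxE; apply: eq_bigr => l _; rewrite addn0 !mxe_ord mxE.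
Qed.

Lemma gram_diag0 (n0 : (0 < n)%N) :
  (H *m H^T) (Ordinal n0) (Ordinal n0) = mxe H 0 0 ^+ 2.
Proof. by rewrite gram_entry bidiag_row0. Qed.

Lemma gram_diagS k (kn : (k.+1 < n)%N) :
  (H *m H^T) (Ordinal kn) (Ordinal kn) = mxe H k.+1 k.+1 ^+ 2 + mxe H k.+1 k ^+ 2.
Proof.
rewrite gram_entry; have := bidiag_rowS 0 (mxe H k.+1) (i := Ordinal kn) isT.
by rewrite /= !addn0 -!expr2.
Qed.

Lemma gram_subdiag k (kn : (k < n)%N) (kn1 : (k.+1 < n)%N) :
  (H *m H^T) (Ordinal kn1) (Ordinal kn) = mxe H k k * mxe H k.+1 k.
Proof.
rewrite gram_entry; have := bidiag_rowS 0 (mxe H k) (i := Ordinal kn1) isT.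
have kk1 : k != k.+1 by lia.
have kk2 : k != k.+2 by lia.
by rewrite /= !addn0 => ->; rewrite (mxe_bidiag kk1 kk2) mulr0 add0r mulrC.
Qed.

Lemma trail_submx_unit k : trail_submx H k \in unitmx.
Proof.
have trig : is_trig_mx (trail_submx H k).
  by apply/is_trig_mxP => i j ij; rewrite mxE mxe_bidiag //; lia.
rewrite unitmxE det_trig // unitfE; apply/prodf_neq0 => i _; rewrite mxE.
by rewrite gt_eqF // mxe_diag_gt0 //; have := ltn_ord i; lia.
Qed.

(** As [(L L^T)^-1 = L^-T L^-1], the left side is [y^T y] with [y = L^-1 f], so solving one linear
    system suffices. *)
Lemma dot_invmx_gram m (L : 'M[C]_m) (f y : 'cV[C]_m) : L \in unitmx -> L *m y = f ->
  (f^T *m (invmx (L *m L^T) *m f)) 0 0 = \sum_(i < m) y i 0 ^+ 2.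
Proof.
move=> Lu Ly.
have LLu : L *m L^T \in unitmx by rewrite unitmx_mul Lu unitmx_tr.
have -> : invmx (L *m L^T) *m f = invmx L^T *m y.
  by apply: (can_inj (mulKmx LLu)); rewrite mulKVmx // -mulmxA mulKVmx ?unitmx_tr.
rewrite -Ly trmx_mul -mulmxA mulKVmx ?unitmx_tr // mxE.
by apply: eq_bigr => i _; rewrite mxE expr2.
Qed.

Lemma trail_inv_entry k : (k < n)%N ->
  let rho := cg_coef (fun j => mxe H j j) (fun j => mxe H j.+1 j) in
  rho k != 0 ->
  rho k ^+ 2 * ((f1 C (n - k))^T *m
    invmx (trail_submx H k *m (trail_submx H k)^T) *m f1 C (n - k)) 0 0 =
  \sum_(i < n - k) (rho (i + k)%N / mxe H (i + k) (i + k)) ^+ 2.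
Proof.
(* The CG coefficients from index [k] on, scaled by [rho k], solve the trailing system: its first
   row gives 1, and each later row is the recurrence [cg_coefS]. *)
move=> kn rho rho0; pose y i := rho (i + k)%N / mxe H (i + k) (i + k) / rho k.
rewrite -mulmxA (dot_invmx_gram (y := \col_i y i)) ?trail_submx_unit //.
  rewrite mulr_sumr; apply: eq_bigr => i _; rewrite mxE /y [in LHS]exprMn exprVn.
  by rewrite mulrC mulfVK // sqrf_eq0.
apply/matrixP => i j; rewrite {j}ord1 !mxE; under eq_bigr do rewrite !mxE.
have al0 l : (l < n)%N -> mxe H l l != 0 by move=> ln; rewrite gt_eqF ?mxe_diag_gt0.
case: i => [[|i] im].
  by rewrite bidiag_row0 // /y !add0n /=; have := al0 _ kn => ?; field; apply/andP.
rewrite (bidiag_rowS k y (i := Ordinal im)) //= /y addSn /rho cg_coefS -/rho.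
have ? : mxe H (i + k) (i + k) != 0 by apply: al0; lia.
have ? : mxe H (i + k).+1 (i + k).+1 != 0 by apply: al0; lia.
by field; apply/and3P.
Qed.

End Bidiagonal.

(** * Coefficient equations read off [T = H H^T], and the final formulas *)

Theorem theorem1p1 (C : numClosedFieldType) (N : nat) (W : 'M[C]_N) (b : 'cV[C]_N)
  (n : nat) (H : 'M[C]_n) :
  is_hermitian W -> is_posdef W -> norm2 b = 1 ->
  lanczos_terminates W b n -> (n <= N)%N ->
  (* H lower bidiagonal with positive diagonal, T(W,b) = H H^T *)
  (forall i j : 'I_n, (i : nat) != j -> (i : nat) != j.+1 -> H i j = 0) ->
  (forall i : 'I_n, 0 < H i i) ->
  jacobi W b n = H *m H^T ->
  let alpha := fun j => mxe H j j in
  let beta := fun j => mxe H j.+1 j in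
  (* (a) CGA *)
  (forall k, (k < n)%N ->
     (exists xk, is_CG_iterate W b k xk) /\
     forall xk, is_CG_iterate W b k xk ->
       norm2 (b - W *m xk) = \prod_(j < k) (beta j / alpha j) /\
       normW W (invmx W *m b - xk) =
         norm2 (b - W *m xk) *
         sqrtC (((f1 C (n - k))^T *m
                  invmx (trail_submx H k *m (trail_submx H k)^T) *m f1 C (n - k))
                  ord0 ord0)) /\
  (* (b) MINRES *)
  (forall k, (k < n)%N ->
     (exists xk, is_MINRES_iterate W b k xk) /\
     forall xk, is_MINRES_iterate W b k xk ->
       norm2 (b - W *m xk) =
         (sqrtC (\sum_(j < k.+1) \prod_(l < j) (alpha l ^+ 2 / beta l ^+ 2)))^-1) /\
  (exists xn, is_MINRES_iterate W b n xn) /\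
  (forall xn, is_MINRES_iterate W b n xn -> b - W *m xn = 0).
Proof.
move=> hW pW b1 lzT _ Hbid Hpos TE al be.
have n0 := proj1 lzT.
have al_gt0 k : (k < n)%N -> 0 < al k by apply: mxe_diag_gt0.
have lbE k : (k < n)%N -> lz_b W b k = al k * be k.
  (* For [k = n - 1] there is no such entry of [T]: both sides vanish, by breakdown on the left and
     by the default value of [mxe] on the right. *)
  move=> kn; have [kN|kN] := eqVneq k.+1 n.
    by rewrite (lz_b_last lzT) // /be mxe_row_out ?mulr0 ?kN.
  have kn1 : (k.+1 < n)%N by lia.
  rewrite -(gram_subdiag Hbid kn kn1) -TE mxE -val_eqE /= eqxx.
  by rewrite gtn_eqF.
have la0E : lz_a W b 0 = al 0%N ^+ 2 by rewrite -(gram_diag0 Hbid n0) -TE mxE eqxx.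
have laSE k : (k.+1 < n)%N -> lz_a W b k.+1 = al k.+1 ^+ 2 + be k ^+ 2.
  by move=> kn; rewrite -(gram_diagS Hbid kn) -TE mxE eqxx.
split; [|split; [|split]].
- move=> k kn; have CGP x := CG_iterateP hW pW b1 lzT al_gt0 lbE la0E laSE x kn.
  split; first by exists (cg_iterate W b al be k); apply/CGP.
  move=> _ /CGP ->; have resE := norm2_cg_residual hW b1 lzT al_gt0 lbE la0E laSE kn.
  split=> //; rewrite resE /normW.
  rewrite (cg_error_sqr hW pW b1 lzT al_gt0 lbE la0E laSE) ?(ltnW kn) //.
  rewrite -(trail_inv_entry Hbid Hpos kn); last exact: (cg_coef_neq0 lzT al_gt0 lbE).
  have rho_gt0 := cg_prod_gt0 lzT al_gt0 lbE kn.
  (* Squaring removes the sign of [rho k], and the positive product then comes out of the root. *)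
  by rewrite cg_coef_sqr rootCMl ?exprn_ge0 ?ltW // sqrCK // ltW.
- move=> k kn; have MRP x := MINRES_iterateP hW pW b1 lzT al_gt0 lbE la0E laSE x kn.
  split; first by exists (minres_iterate W b al be k); apply/MRP.
  move=> _ /MRP ->; rewrite (norm2_minres_residual hW b1 lzT al_gt0 lbE la0E laSE kn).
  congr (sqrtC _)^-1; apply: eq_bigr => j _; rewrite cg_coef_sqr -prodrXl -prodfV.
  by apply: eq_bigr => l _; rewrite exprMn exprVn invfM invrK mulrC.
- exists (cg_iterate W b al be n).
  exact/(MINRES_iterate_lastP pW lzT al_gt0 lbE la0E laSE).
move=> x /(MINRES_iterate_lastP pW lzT al_gt0 lbE la0E laSE) ->.
by rewrite (mul_cg_iterate_last lzT al_gt0 lbE la0E laSE) subrr.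
Qed.
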